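(* Let $F$ be a field, let $A=M_n(F)$, and let $\omega(x,y)=\mathrm{tr}(xy)$ be the trace form on $A$. There are no Rota--Baxter operators $R$ of a nonzero weight $\lambda\in F$ on $A$ satisfying the equality $R+R^*+\lambda\,\mathrm{id}=0$.
   Context: A Rota--Baxter operator of weight $\lambda$ on an algebra $A$ is a linear map $R\colon A\to A$ with $R(x)R(y)=R(R(x)y+xR(y)+\lambda xy)$ for all $x,y\in A$. $R^*$ denotes the adjoint of $R$ with respect to the trace form: $\omega(R(x),y)=\omega(x,R^*(y))$ for all $x,y\in A$. *)

(* Defs.v *)
From HB Require Import structures.
From mathcomp Require Import all_boot all_order all_algebra.

Set Implicit Arguments.
Unset Strict Implicit.
Unset Printing Implicit Defensive.

Import GRing.Theory.
Local Open Scope ring_scope.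

Definition rota_baxter (F : fieldType) (A : algType F) (lambda : F)
    (R : {linear A -> A}) : Prop :=
  forall x y : A, R x * R y = R (R x * y + x * R y + lambda *: (x * y)).

Definition trace_form (F : fieldType) (n : nat) (x y : 'M[F]_n.+1) : F :=
  \tr (x * y).

(* The trace form is nondegenerate, so every R has exactly one adjoint: see
   [trace_adjoint_exists] and [trace_adjoint_unique]. *)
Definition is_trace_adjoint (F : fieldType) (n : nat)
    (R Rstar : {linear 'M[F]_n.+1 -> 'M[F]_n.+1}) : Prop :=
  forall x y, trace_form (R x) y = trace_form x (Rstar y).

Lemma trace_form_delta (F : fieldType) (n : nat) (i j : 'I_n.+1)
    (y : 'M[F]_n.+1) : trace_form (delta_mx j i) y = y i j.
Proof.
rewrite /trace_form /mxtrace (bigD1 j) //= big1 => [|k kj]; last first.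
  by rewrite mxE big1 // => l _; rewrite mxE (negbTE kj) mul0r.
rewrite addr0 mxE (bigD1 i) //= big1 => [|l li].
  by rewrite mxE !eqxx mul1r addr0.
by rewrite mxE (negbTE li) andbF mul0r.
Qed.

Lemma trace_adjoint_unique (F : fieldType) (n : nat)
    (R S T : {linear 'M[F]_n.+1 -> 'M[F]_n.+1}) :
  is_trace_adjoint R S -> is_trace_adjoint R T -> S =1 T.
Proof.
move=> RS RT y; apply/matrixP => i j.
by rewrite -!trace_form_delta -RS -RT.
Qed.

Lemma trace_adjoint_exists (F : fieldType) (n : nat)
    (R : {linear 'M[F]_n.+1 -> 'M[F]_n.+1}) :
  exists Rstar : {linear 'M[F]_n.+1 -> 'M[F]_n.+1}, is_trace_adjoint R Rstar.
Proof.
pose f y : 'M[F]_n.+1 := \matrix_(i, j) trace_form (R (delta_mx j i)) y.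
have f_lin : linear f.
  move=> a u v; apply/matrixP => i j.
  by rewrite !mxE /trace_form mulrDr -scalerAr mxtraceD mxtraceZ.
pose fL := GRing.isLinear.Build F _ _ _ f f_lin.
pose fT : {linear 'M[F]_n.+1 -> 'M[F]_n.+1} := HB.pack f fL.
exists fT => x y; rewrite [x]matrix_sum_delta.
rewrite /trace_form linear_sum !mulr_suml !linear_sum; apply: eq_bigr => i _.
rewrite linear_sum !mulr_suml !linear_sum; apply: eq_bigr => j _.
rewrite linearZ /= -!scalerAl !mxtraceZ; congr (_ * _).
by rewrite -[RHS]/(trace_form _ (f y)) trace_form_delta mxE.
Qed.

(* Main.v *)
(** Put [S := R + lambda id].  The linear map [x |-> (R x, S x)] identifies the
    space of matrices, with the associative product
    [x o y := R x y + x R y + lambda x y], with a subalgebra of [A * A].  The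
    skew-adjointness condition says that [tr (x o y) = 0], hence
    [tr (S x S y) = tr (R x R y)] for all [x] and [y].  By Fitting's lemma,
    applied inside the subalgebra generated by [x], every [x] is the sum of an
    [o]-nilpotent element and of an element of [x o A].  The trace of [R] and
    of [S] vanishes on the former, and [tr (S u) = tr (R u)] on the latter, so
    [tr (R x) = tr (S x)], that is, [lambda tr x = 0] for every [x]. *)
Require Import Defs.
From mathcomp Require Import all_boot all_order all_algebra.
From mathcomp Require Import ring.

Set Implicit Arguments.
Unset Strict Implicit.
Unset Printing Implicit Defensive.

Import GRing.Theory.
Local Open Scope ring_scope.

(** Determinants in the factorization of ['X^m - N^m] by ['X - N] force the characteristic
    polynomial to be a power of ['X]. *)
Lemma mxtrace_nilpotent (F : fieldType) (n m : nat) (N : 'M[F]_n.+1) :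
  N ^+ m = 0 -> \tr N = 0.
Proof.
move=> N0; pose P := map_mx polyC N.
have cXP : GRing.comm ('X%:M : 'M_n.+1) P by exact: comm_scalar_mx.
have P0 : P ^+ m = 0 by rewrite -rmorphXn /= N0 map_mx0.
have char_dvd : char_poly N %| ('X - 0%:P) ^+ (m * n.+1).
  have := congr1 determinant (subrXX_comm m cXP).
  rewrite P0 subr0 -rmorphXn /= det_scalar -exprM det_mulmx polyC0 subr0 => ->.
  exact: dvdp_mulr.
have [k _] := dvdp_exp_XsubCP char_dvd.
rewrite polyC0 subr0 eqp_monic ?char_poly_monic ?monicXn // => /eqP charE.
have := size_char_poly N; rewrite charE size_polyXn => -[k_eq].
have := char_poly_trace N isT.
rewrite charE k_eq coefXn /= ltn_eqF // => /eqP.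
by rewrite eq_sym oppr_eq0 => /eqP.
Qed.

Lemma eq_mxtrace_horner (F : fieldType) (n : nat) (a b : 'M[F]_n.+1) :
  (forall p, \tr (a * (a * horner_mx a p)) = \tr (b * (b * horner_mx b p))) ->
  \tr a = \tr b.
Proof.
(* A common annihilator, so that one [g] and one [c] serve both [a] and [b]:
   ['X * q = 'X^2 * g + c 'X] is nilpotent at each, which determines [c * tr]. *)
move=> tr_ab; pose p := char_poly a * char_poly b.
have p_neq0 : p != 0 by rewrite mulf_neq0 ?monic_neq0 ?char_poly_monic.
have [m [q]] := multiplicity_XsubC p 0.
rewrite p_neq0 polyC0 subr0 /= => q0_neq0 pE.
pose c := q.[0].
have /factor_theorem[g] : root (q - c%:P) 0 by rewrite rootE !hornerE subrr.
rewrite polyC0 subr0 => /(canRL (subrK _)) qE.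
have tr_decomp (d : 'M[F]_n.+1) : horner_mx d p = 0 ->
    \tr (d * (d * horner_mx d g)) + c * \tr d = 0.
  move=> pd0.
  (* The exponent [m.+1] also covers [m = 0]. *)
  have /mxtrace_nilpotent <- : horner_mx d ('X * q) ^+ m.+1 = 0.
    rewrite -rmorphXn /= exprMn.
    have -> : 'X ^+ m.+1 * q ^+ m.+1 = p * ('X * q ^+ m).
      by rewrite pE exprS [q ^+ _]exprS; ring.
    by rewrite rmorphM /= pd0 mul0r.
  rewrite -mxtraceZ -mxtraceD; congr (\tr _).
  rewrite rmorphM qE [g * 'X]mulrC rmorphD rmorphM /= horner_mx_X horner_mx_C.
  by rewrite mulrDr -mul_mx_scalar.
have pa0 : horner_mx a p = 0 by rewrite rmorphM /= Cayley_Hamilton mul0r.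
have pb0 : horner_mx b p = 0 by rewrite rmorphM /= Cayley_Hamilton mulr0.
have := tr_decomp a pa0; rewrite -(tr_decomp b pb0) tr_ab => /addrI.
exact: mulfI.
Qed.

Definition rb_mul (F : fieldType) (A : algType F) (lambda : F)
    (R : A -> A) (x y : A) : A :=
  R x * y + x * R y + lambda *: (x * y).

Lemma mulr_rb_mul (F : fieldType) (A : algType F) (lambda : F)
    (R : A -> A) (x y : A) :
  (R x + lambda *: x) * (R y + lambda *: y) =
  R x * R y + lambda *: rb_mul lambda R x y.
Proof.
rewrite /rb_mul mulrDl !mulrDr -!scalerAr -!scalerAl !scalerDr !addrA.
by rewrite [R x * R y + _ + _]addrAC.
Qed.

Lemma rota_baxter_horner (F : fieldType) (n : nat) (lambda : F)
    (R : {linear 'M[F]_n.+1 -> 'M[F]_n.+1}) (x : 'M[F]_n.+1) (p : {poly F}) :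
  rota_baxter lambda R ->
  let a := R x in let b := R x + lambda *: x in
  exists2 z, R z = a * horner_mx a p & R z + lambda *: z = b * horner_mx b p.
Proof.
move=> RB a b; elim/poly_ind: p => [|p c [z Rz Sz]].
  by exists 0; rewrite !rmorph0 !mulr0 ?linear0 ?scaler0 ?addr0.
have hornerE d : d * horner_mx d (p * 'X + c%:P) =
    d * horner_mx d p * d + c *: d.
  by rewrite rmorphD rmorphM /= horner_mx_X horner_mx_C mulrDr mulrA
             -mul_mx_scalar.
have Rz' : R (rb_mul lambda R z x + c *: x) = R z * a + c *: a.
  by rewrite linearD linearZ -RB.
(* Right [rb_mul] by [x] multiplies by [a] under [R] and by [b] under [R + lambda id]. *)
exists (rb_mul lambda R z x + c *: x); rewrite hornerE.
  by rewrite Rz' Rz.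
rewrite Rz' -Sz mulr_rb_mul !scalerDr addrACA; congr (_ + (_ + _)).
by rewrite !scalerA mulrC.
Qed.

Theorem theorem6 (F : fieldType) (n : nat) (lambda : F) :
  lambda != 0 ->
  ~ exists R Rstar : {linear 'M[F]_n.+1 -> 'M[F]_n.+1},
      [/\ rota_baxter lambda R,
          is_trace_adjoint R Rstar
        & forall x : 'M[F]_n.+1, R x + Rstar x + lambda *: x = 0].
Proof.
move=> lambda_neq0 [R [Rstar [RB adj skew]]].
have tr_rb_mul x y : \tr (rb_mul lambda R x y) = 0.
  have := adj x y; rewrite /trace_form /rb_mul => adj_xy.
  (* Moving [R] off [x] leaves the trace of [x * (Rstar y + R y + lambda *: y)]. *)
  rewrite !mxtraceD adj_xy scalerAr -!mxtraceD -!mulrDr.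
  by rewrite [Rstar y + _]addrC skew mulr0 mxtrace0.
have tr_RS x : \tr (R x) = \tr (R x + lambda *: x).
  apply: eq_mxtrace_horner => p.
  have [z /= <- <-] := rota_baxter_horner x p RB.
  by rewrite mulr_rb_mul mxtraceD mxtraceZ tr_rb_mul mulr0 addr0.
have tr0 (x : 'M[F]_n.+1) : \tr x = 0.
  have := tr_RS x; rewrite mxtraceD mxtraceZ -[LHS]addr0 => /addrI /esym/eqP.
  by rewrite mulf_eq0 (negbTE lambda_neq0) => /eqP.
(* A matrix unit has trace one, whereas the trace of the identity may vanish in positive
   characteristic. *)
have := trace_form_delta ord0 ord0 (1 : 'M[F]_n.+1).
by rewrite /trace_form tr0 mxE eqxx => /esym/eqP; rewrite oner_eq0.
Qed.
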